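(* Let $K$ be a simplicial complex with at least one non-conelike vertex. Then the complex moment-angle complex $Z_K(D^2,S^1)$ is not aspherical.
   Context: Let $K$ be a simplicial complex on the vertex set $[m]=\{1,\dots,m\}$. A vertex $i$ of $K$ is called conelike if it is joined by an edge of $K$ to every other vertex of $K$; otherwise it is non-conelike. Let $D^2\subset\mathbb{C}$ be the unit disk and $S^1=\partial D^2$. The complex moment-angle complex of $K$ is $$Z_K(D^2,S^1)=\bigcup_{J\in K}\left(\prod_{i\in J} D^2\times\prod_{i\in[m]\setminus J} S^1\right)\subseteq (D^2)^m,$$ the union being over all simplices $J\subseteq[m]$ of $K$. *)

(* Defs.v *)
From HB Require Import structures.
From mathcomp Require Import all_boot all_order all_algebra.
From mathcomp Require Import all_classical all_reals all_analysis.
From mathcomp Require Import complex.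

Set Implicit Arguments.
Unset Strict Implicit.
Unset Printing Implicit Defensive.

Import Order.TTheory GRing.Theory Num.Theory.
Import numFieldNormedType.Exports.

Local Open Scope classical_set_scope.
Local Open Scope ring_scope.

(* The vertex set [m] is 'I_m, and every element of 'I_m is a vertex of K. *)
Definition simplicial_complex (m : nat) (K : {set {set 'I_m}}) : Prop :=
  [/\ (finset.set0 : {set 'I_m}) \in K,
      forall i : 'I_m, [set i]%SET \in K &
      forall I J : {set 'I_m}, J \in K -> I \subset J -> I \in K].

Definition conelike (m : nat) (K : {set {set 'I_m}}) (i : 'I_m) : Prop :=
  forall j : 'I_m, j != i -> [set i; j]%SET \in K.

(* R[i] carries its metric topology under the alias R[i]^o.  Its norm is
   R[i]-valued, so `|z| <= 1 is an inequality in R[i] between real elements. *)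
Definition disk2 (R : realType) : set R[i]^o := [set z : R[i]^o | `|z : R[i]| <= 1].

Definition circle1 (R : realType) : set R[i]^o := [set z : R[i]^o | `|z : R[i]| = 1].

(* C^m is 'rV[R[i]^o]_m with the topology of entrywise convergence, which is
   the product topology. *)
Definition moment_angle (R : realType) (m : nat) (K : {set {set 'I_m}}) :
    set 'rV[R[i]^o]_m :=
  \bigcup_(J in [set J : {set 'I_m} | J \in K])
    [set z : 'rV[R[i]^o]_m | forall i : 'I_m,
       if i \in J then disk2 (z ord0 i) else circle1 (z ord0 i)].
Arguments moment_angle R [m] K.

Definition cube (R : realType) (n : nat) : set 'rV[R]_n :=
  [set t | forall i, 0 <= t ord0 i <= 1].

Definition cube_boundary (R : realType) (n : nat) : set 'rV[R]_n :=
  [set t | cube t /\ exists i, t ord0 i = 0 \/ t ord0 i = 1].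

(* A space is a subset X of a topological space T with the subspace topology;
   a map into X is a function to T with values in X, whose values outside the
   stated domain are irrelevant. *)
Definition path_connected_set (R : realType) (T : topologicalType)
    (X : set T) : Prop :=
  forall x y, X x -> X y ->
    exists p : R -> T,
      [/\ {within `[0, 1], continuous p},
          forall s, 0 <= s <= 1 -> X (p s),
          p 0 = x & p 1 = y].

(* Maps of pairs (I^n, bd I^n) -> (X, x), i.e. representatives of the elements
   of pi_n(X, x). *)
Definition spheroid (R : realType) (T : topologicalType) (X : set T) (x : T)
    (n : nat) (f : 'rV[R]_n -> T) : Prop :=
  [/\ {within @cube R n, continuous f},
      forall t, cube t -> X (f t) &
      forall t, cube_boundary t -> f t = x].

Definition spheroid_homotopic (R : realType) (T : topologicalType) (X : set T)
    (x : T) (n : nat) (f g : 'rV[R]_n -> T) : Prop :=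
  exists H : R * 'rV[R]_n -> T,
    [/\ {within `[0, 1] `*` @cube R n, continuous H},
        forall s, 0 <= s <= 1 -> spheroid X x (fun t => H (s, t)),
        forall t, cube t -> H (0, t) = f t &
        forall t, cube t -> H (1, t) = g t].

(* pi_n(X, x) = 0: every class is the class of the constant map. *)
Definition homotopy_group_trivial (R : realType) (T : topologicalType)
    (X : set T) (x : T) (n : nat) : Prop :=
  forall f : 'rV[R]_n -> T,
    spheroid X x f -> spheroid_homotopic X x f (fun=> x).

(* R only supplies the unit interval. *)
Definition aspherical (R : realType) (T : topologicalType) (X : set T) :
    Prop :=
  path_connected_set R X /\
  forall (n : nat) (x : T), (2 <= n)%N -> X x ->
    homotopy_group_trivial R X x n.

(* Main.v *)
Require Import Defs.
From mathcomp Require Import all_boot all_order all_algebra.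
From mathcomp Require Import all_classical all_reals all_analysis.
From mathcomp Require Import complex.
From mathcomp Require Import ring lra.
Import numFieldNormedType.Exports.

(* If {i, j} is not an edge of K, then the coordinates (z_i, z_j) never vanish
   simultaneously on Z_K, and Z_K contains a copy of the 3-sphere
   max(|z_i|, |z_j|) = 1, all other coordinates being 1.  The degree one map from
   the 3-cube modulo its boundary to this sphere is not null in Z_K: composing a
   null homotopy with (z_i, z_j) would give a nowhere zero map on the 4-cube which
   is never antipodal to the radial map on the boundary, against Brouwer's theorem.
   Brouwer's theorem follows from a cubical Sperner lemma, proved by applying
   Stokes' formula to a mod 2 cup product of cubical 1-cochains. *)

Set Implicit Arguments.
Unset Strict Implicit.
Unset Printing Implicit Defensive.
Import Order.TTheory GRing.Theory Num.Theory.
Local Open Scope classical_set_scope.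
Local Open Scope ring_scope.

(** * A cubical Sperner lemma *)

Lemma addF2 (x : 'F_2) : x + x = 0.
Proof. by apply: addrr_pchar2; rewrite pchar_Fp. Qed.

(** The terms at [(a, b)] and [(b, a)] are equal, so they cancel modulo 2. *)
Lemma sum_sym_F2 (n : nat) (S : {set 'I_n}) (f : 'I_n -> 'I_n -> 'F_2) :
  (forall a b, f a b = f b a) ->
  \sum_(a in S) \sum_(b in S :\ a) f a b = 0.
Proof.
move=> fC.
have splitS (a : 'I_n) : \sum_(b in S :\ a) f a b =
    \sum_(b in S | (a < b)%N) f a b + \sum_(b in S | (b < a)%N) f a b.
  rewrite (bigID (fun b : 'I_n => (a < b)%N)) /=; congr (_ + _); apply: eq_bigl => b.
    by rewrite !inE -val_eqE /=; case: ltngtP; rewrite ?andbF ?andbT.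
  by rewrite !inE -val_eqE /=; case: ltngtP; rewrite ?andbF ?andbT.
rewrite (eq_bigr _ (fun a _ => splitS a)) big_split /=.
rewrite [X in _ + X](exchange_big_dep (mem S)) //=; last by move=> a b _ /andP[].
rewrite -[X in _ = X](addF2 (\sum_(a in S) \sum_(b in S | (a < b)%N) f a b)).
congr (_ + _); apply: eq_bigr => a aS; apply: eq_big => b; first by rewrite aS.
by rewrite fC.
Qed.

(** * Cup products of cubical coboundaries modulo 2 *)

Section Cup.
Variable n : nat.
Local Notation pt := ('I_n -> nat).
Implicit Types (l : 'I_n -> pt -> 'F_2) (v : pt) (S : {set 'I_n}) (L : seq 'I_n).

Definition step v (a : 'I_n) : pt := fun i => (v i + (i == a))%N.

Lemma stepC v a b : step (step v a) b = step (step v b) a.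
Proof. by apply: funext => i; rewrite /step addnAC. Qed.

(* The cup product of the cubical cochains [d (l b)], [b] in [L], evaluated on
   the cube at [v] spanned by the directions in [S]: a sum over the monotone edge
   paths of that cube.  Working mod 2 removes all signs. *)
Fixpoint cup l v S L : 'F_2 :=
  if L is b :: L' then
    \sum_(a in S) (l b (step v a) + l b v) * cup l (step v a) (S :\ a) L'
  else 1.

(** Leibniz rule with a closed second factor: adding [l b v] times the hypothesis trades
    [l b v * cup l (step v a) (S :\ a) L] for the same term based at [v]. Closedness is a hypothesis
    so that the induction in [cup_closed] can supply it. *)
Lemma cup_exact l v S b L :
  \sum_(a in S) (cup l (step v a) (S :\ a) L + cup l v (S :\ a) L) = 0 ->
  cup l v S (b :: L) =
  \sum_(a in S) (l b (step v a) * cup l (step v a) (S :\ a) L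
                 + l b v * cup l v (S :\ a) L).
Proof.
move=> h; have lh := congr1 (fun x => l b v * x) h; rewrite mulr0 mulr_sumr in lh.
rewrite -[LHS]addr0 -[X in _ + X]lh -big_split /=; apply: eq_bigr => a _.
by rewrite mulrDl mulrDr addrA -[X in X + _]addrA addF2 addr0.
Qed.

(* The cup product of coboundaries is a cocycle: it vanishes on the boundary of
   a cube.  Each codimension 2 face lies in two facets. *)
Lemma cup_closed l v S L :
  \sum_(a in S) (cup l (step v a) (S :\ a) L + cup l v (S :\ a) L) = 0.
Proof.
elim: L v S => [|b L IH] v S; first by rewrite big1 // => a _; exact: addF2.
(* The four faces of codimension 2 orthogonal to the directions [a] and [c], each weighted by [l b]
   at its base point; the expression is symmetric in [a] and [c]. *)
pose f a c := l b (step (step v a) c) * cup l (step (step v a) c) (S :\ a :\ c) L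
  + l b (step v a) * cup l (step v a) (S :\ a :\ c) L
  + (l b (step v c) * cup l (step v c) (S :\ a :\ c) L
  + l b v * cup l v (S :\ a :\ c) L).
rewrite -[RHS](@sum_sym_F2 _ S f); last first.
  move=> a c; rewrite /f stepC.
  rewrite (_ : S :\ a :\ c = S :\ c :\ a); last by apply/setP => i; rewrite !inE andbCA.
  rewrite -!addrA; congr (_ + _); rewrite addrCA; congr (_ + _).
apply: eq_bigr => a _; rewrite !cup_exact; try exact: IH.
by rewrite -big_split.
Qed.

(** Stokes' formula: the product is the coboundary of [l b] times the product over [L]. *)
Lemma cup_boundary l v S b L :
  cup l v S (b :: L) =
  \sum_(a in S) (l b (step v a) * cup l (step v a) (S :\ a) L
                 + l b v * cup l v (S :\ a) L).
Proof. exact/cup_exact/cup_closed. Qed.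

(** The cube has no edge in direction [a], so [l a] is constant on it and the factor given by its
    coboundary vanishes. *)
Lemma cup_face0 l v S L (a : 'I_n) :
  (forall w w', w a = v a -> w' a = v a -> l a w = l a w') ->
  a \in L -> a \notin S -> cup l v S L = 0.
Proof.
move=> la; elim: L v S la => [//|b L IH] v S la aL aS.
have stepaE c : c \in S -> step v c a = v a.
  by move=> cS; rewrite /step; case: eqP cS aS => [<- -> //|]; rewrite addn0.
rewrite /= big1 // => c cS; have vca := stepaE _ cS.
move: aL; rewrite inE => /predU1P[ab|aL]; last first.
  by rewrite IH ?mulr0 // ?inE ?negb_and ?aS ?orbT // vca.
by rewrite -ab (la _ v) // addF2 mul0r.
Qed.

(** Some monotone edge path contributes a nonzero term; its edge for the factor [b] has ends with
    different labels. *)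
Lemma cup_neq0 l v S L b : cup l v S L != 0 -> b \in L ->
  exists w w', [/\ l b w != l b w', forall i, (v i <= w i <= v i + (i \in S))%N
                 & forall i, (v i <= w' i <= v i + (i \in S))%N].
Proof.
elim: L v S => [//|c L IH] v S /= nz bL.
have [a aS] : exists2 a, a \in S &
    (l c (step v a) + l c v) * cup l (step v a) (S :\ a) L != 0.
  apply/exists_inP; apply: contraNT nz; rewrite negb_exists_in => /forall_inP h.
  by apply/eqP; rewrite big1 // => a /h; rewrite negbK => /eqP.
rewrite mulf_eq0 negb_or => /andP[lc nz'].
have le_step i : (v i <= step v a i <= v i + (i \in S))%N.
  rewrite /step leq_addr leq_add2l; case: eqP => // ->; by rewrite aS.
move: bL; rewrite inE => /predU1P[->|bL].
  exists (step v a), v; split=> // [|i]; last by rewrite leqnn leq_addr.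
  by apply: contraNneq lc => ->; rewrite addF2.
have [w [w' [lw hw hw']]] := IH _ _ nz' bL.
have le_trans u i : (step v a i <= u i <= step v a i + (i \in S :\ a))%N ->
    (v i <= u i <= v i + (i \in S))%N.
  move=> /andP[h1 h2]; have /andP[h3 h4] := le_step i.
  rewrite (leq_trans h3) //= (leq_trans h2) // /step -addnA leq_add2l !inE.
  by case: eqP => [->|]; rewrite ?aS ?addn0.
by exists w, w'; split=> // i; exact: le_trans.
Qed.

(** * Summation over a grid *)

Section Box.
Variable k : nat.
Local Notation gpt := {ffun 'I_n -> 'I_k.+1}.

Definition natpt (v : gpt) : pt := fun i => v i.

(* Base points of the unit cubes in the face of [[0, k]^n] spanned by [S] on
   which the other coordinates equal [k]. *)
Definition box S (v : gpt) :=
  [forall a, if a \in S then (v a < k)%N else v a == ord_max].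

Definition upd (T : Type) (v : 'I_n -> T) (a : 'I_n) (t : T) :=
  fun i => if i == a then t else v i.

Lemma boxP S (v : gpt) : reflect (forall a, if a \in S then (v a < k)%N else v a == ord_max)
  (box S v).
Proof. exact: forallP. Qed.

(** The base points are grouped into lines in direction [a]. A line is represented by its point with
    coordinate [a] equal to [k], the value that [box (S :\ a)] imposes. *)
Lemma sum_box S a (F : pt -> 'F_2) : a \in S ->
  \sum_(v : gpt | box S v) F (natpt v) =
  \sum_(u | box (S :\ a) u) \sum_(t < k) F (upd (natpt u) a t).
Proof.
move=> aS; pose p (v : gpt) : gpt := finfun (upd v a ord_max).
have pbox (v : gpt) : box S v -> box (S :\ a) (p v).
  move=> /boxP h; apply/boxP => i; have := h i; rewrite !inE ffunE /upd.
  by case: (i =P a) => [_|_] /=; [rewrite eqxx|].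
rewrite (partition_big p (box (S :\ a))) //=; apply: eq_bigr => u /boxP hu.
have ua : u a = ord_max by have := hu a; rewrite !inE eqxx => /eqP.
pose h (t : 'I_k) : gpt := finfun (upd u a (widen_ord (leqnSn k) t)).
(* For [k = 0] both sides vanish. Otherwise ['I_k] has an element to serve as the default of
   [insubd], never reached since [v a < k] in the box. *)
case: (posnP k) => k0.
  rewrite [RHS]big1 => [|t _]; last by have := ltn_ord t; rewrite {2}k0.
  rewrite big1 // => v /andP[/boxP /(_ a)]; rewrite aS => lt_vk.
  by exfalso; have := leq_ltn_trans (leq0n _) lt_vk; rewrite k0.
pose t0 : 'I_k := Ordinal k0.
rewrite (reindex_onto h (fun v : gpt => insubd t0 (v a : nat))) /=; last first.
  move=> v /andP[/boxP hv /eqP pv]; apply/ffunP => i; rewrite ffunE /upd -pv.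
  case: eqP => [->|/eqP ni]; last by rewrite ffunE /upd (negbTE ni).
  apply: val_inj; rewrite /= val_insubd; have := hv a; by rewrite aS => ->.
apply: eq_big => [t|t _]; last first.
  congr F; apply: funext => i; rewrite /natpt ffunE /upd; by case: eqP.
rewrite [RHS]/=; apply/andP; split; [apply/andP; split|].
- apply/boxP => i; rewrite ffunE /upd; have := hu i; rewrite !inE.
  by case: eqP => [-> _|_ //]; rewrite aS /=.
- apply/eqP/ffunP => i; rewrite !ffunE /upd; case: eqP => [->//|]; rewrite ffunE /upd.
  by case: eqP.
- by apply/eqP/val_inj; rewrite val_insubd ffunE /upd eqxx /= ltn_ord.
Qed.

Lemma telescope_F2 (F : nat -> 'F_2) :
  \sum_(t < k) (F t.+1 + F t) = F k + F 0%N.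
Proof.
elim: k => [|m IH]; first by rewrite big_ord0 addF2.
by rewrite big_ord_recr /= IH addrC -addrA [X in _ + X]addrA addF2 add0r.
Qed.

Lemma upd_id (T : Type) (v : 'I_n -> T) a : upd v a (v a) = v.
Proof. by apply: funext => i; rewrite /upd; case: eqP => // ->. Qed.

Lemma step_upd v a t : step (upd v a t) a = upd v a t.+1.
Proof.
by apply: funext => i; rewrite /step /upd; case: eqP => _; rewrite ?addn1 ?addn0.
Qed.

(* By [cup_boundary] the sum telescopes onto the faces of the big cube; all of
   them vanish except [v b = k], [b] the head of [L]. *)
Lemma sum_cup l L :
  (forall a v, v a = 0%N -> l a v = 0) -> (forall a v, v a = k -> l a v = 1) ->
  uniq L -> \sum_(v : gpt | box [set a in L] v) cup l (natpt v) [set a in L] L = 1.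
Proof.
move=> l0 l1; elim: L => [_|b L IH].
  rewrite (big_pred1 [ffun=> ord_max]) // => v.
  apply/boxP/eqP => [h|-> a]; last by rewrite inE in_nil ffunE.
  by apply/ffunP => a; have := h a; rewrite inE in_nil ffunE => /eqP.
rewrite cons_uniq => /andP[bL uL].
set S := [set a in b :: L].
have bS : b \in S by rewrite !inE eqxx.
have SbE : S :\ b = [set a in L].
  by apply/setP => i; rewrite !inE; case: eqP => //= ->; rewrite (negbTE bL).
under eq_bigr do rewrite cup_boundary.
rewrite exchange_big /= (bigD1 b) //= [X in _ + X]big1 ?addr0.
  pose G v := l b v * cup l v (S :\ b) L.
  rewrite (sum_box (fun v => G (step v b) + G v) bS) -(IH uL) SbE.
  apply: eq_bigr => u hu.
  under eq_bigr do rewrite step_upd.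
  rewrite (telescope_F2 (fun t => G (upd (natpt u) b t))) /G.
  rewrite (l0 b (upd _ _ 0%N)) ?mul0r ?addr0; last by rewrite /upd eqxx.
  rewrite (l1 b (upd _ _ k)) ?mul1r; last by rewrite /upd eqxx.
  (* The upper end of the line is [u] itself, so what remains is the sum of the induction
     hypothesis. *)
  have ub : natpt u b = k.
    by have /boxP/(_ b) := hu; rewrite inE (negbTE bL) => /eqP; rewrite /natpt => ->.
  by rewrite -[X in upd _ _ X]ub upd_id SbE.
(* For [a] other than [b], the label [l a] is constant on each of the facets [v a = 0] and
   [v a = k], and [cup_face0] applies to both. *)
move=> a /andP[aS ab].
have aL : a \in L by move: aS; rewrite !inE (negbTE ab).
pose G v := l b v * cup l v (S :\ a) L.
rewrite (sum_box (fun v => G (step v a) + G v) aS).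
apply: big1 => u hu.
under eq_bigr do rewrite step_upd.
rewrite (telescope_F2 (fun t => G (upd (natpt u) a t))) /G.
rewrite !(@cup_face0 _ _ _ _ a) ?mulr0 ?addr0 ?inE ?eqxx //.
- by move=> w w'; rewrite /upd eqxx => h h'; rewrite !l0.
- by move=> w w'; rewrite /upd eqxx => h h'; rewrite !l1.
Qed.

End Box.
End Cup.

(** The product of the coboundaries of all labels sums to 1 over the unit cubes, hence is nonzero on
    one of them, and there every label takes both values. *)
Lemma cubical_sperner (n k : nat) (l : 'I_n -> ('I_n -> nat) -> bool) :
  (forall a v, v a = 0%N -> ~~ l a v) -> (forall a v, v a = k -> l a v) ->
  exists v : 'I_n -> nat, (forall a, v a < k)%N /\
    forall a, exists w w', [/\ l a w, ~~ l a w',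
      forall i, (v i <= w i <= (v i).+1)%N & forall i, (v i <= w' i <= (v i).+1)%N].
Proof.
move=> l0 l1; pose L a v : 'F_2 := (l a v)%:R.
have := @sum_cup n k L (enum 'I_n).
rewrite enum_uniq => /(_ _ _ isT) sum1.
have {}sum1 : \sum_(v | box (k:=k) [set a in enum 'I_n] v)
    cup L (natpt v) [set a in enum 'I_n] (enum 'I_n) != 0.
  rewrite sum1 ?oner_neq0 // => a v h; rewrite /L.
    by rewrite (negbTE (l0 _ _ h)).
  by rewrite (l1 _ _ h).
have [v hv nz] : exists2 v, box (k:=k) [set a in enum 'I_n] v &
    cup L (natpt v) [set a in enum 'I_n] (enum 'I_n) != 0.
  apply/exists_inP; apply: contraNT sum1; rewrite negb_exists_in => /forall_inP h.
  by apply/eqP; rewrite big1 // => v /h; rewrite negbK => /eqP.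
exists (natpt v); split=> a.
  by have /boxP/(_ a) := hv; rewrite inE mem_enum.
have [w [w' [lw hw hw']]] := cup_neq0 nz (mem_enum _ a).
have ww (u : 'I_n -> nat) :
    (forall i, (natpt v i <= u i <= natpt v i + (i \in [set a in enum 'I_n]))%N) ->
    forall i, (natpt v i <= u i <= (natpt v i).+1)%N.
  by move=> hu i; have := hu i; rewrite inE mem_enum addn1.
move: lw; rewrite /L; case lw: (l a w); case lw' : (l a w'); rewrite ?eqxx // => _.
  by exists w, w'; rewrite lw lw'; split=> //; exact: ww.
by exists w', w; rewrite lw lw'; split=> //; exact: ww.
Qed.

(** * Brouwer's fixed point theorem for cubes *)

Lemma cube_compact (R : realType) n : compact (@cube R n).
Proof.
have -> : @cube R n = [set v : 'rV[R]_n | forall i, `[0 : R, 1]%classic (v ord0 i)].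
  by apply/seteqP; split => v h i; have := h i; rewrite /= in_itv.
by apply: (@rV_compact _  _ (fun=> `[0 : R, 1]%classic)) => _; exact: segment_compact.
Qed.

(** The Sperner lemma is applied to a grid of mesh less than [e], label [a] telling whether [f] does
    not increase coordinate [a]. The witnesses are vertices of one cell and depend on [a]. *)
Lemma cube_almost_fixed (R : realType) n (f : 'rV[R]_n -> 'rV[R]_n) (e : R) :
  (forall t, cube t -> cube (f t)) -> 0 < e ->
  exists2 c, cube c & forall a, exists x y,
    [/\ cube x /\ ball c e x, cube y /\ ball c e y,
        f x ord0 a <= x ord0 a & y ord0 a <= f y ord0 a].
Proof.
move=> fcube e0.
have [k ke] : exists k : nat, k.+1%:R^-1 < e.
  exists (Num.trunc e^-1); rewrite invf_plt ?posrE ?ltr0Sn //; exact: truncnS_gt.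
have k0 : 0 < k.+1%:R :> R by rewrite ltr0Sn.
pose grid (v : 'I_n -> nat) : 'rV[R]_n := \row_a ((v a)%:R / k.+1%:R).
have grid_cube v : (forall a, (v a <= k.+1)%N) -> cube (grid v).
  by move=> vk a; rewrite mxE divr_ge0 ?ler0n //= ler_pdivrMr // mul1r ler_nat.
(* The tests on [v a] force the labels required on the facets. Where they override the comparison,
   coordinate [a] is 0 or 1 and [fcube] gives the inequality wanted. *)
pose l a v := (v a != 0%N) && ((k.+1 <= v a)%N || (f (grid v) ord0 a <= grid v ord0 a)).
have [|a v va|v [vk cell]] := @cubical_sperner n k.+1 l.
- by move=> a v va; rewrite /l va.
- by rewrite /l va leqnn.
exists (grid v); first by apply: grid_cube => a; apply: ltnW.
move=> a; have [w [w' [lw lw' hw hw']]] := cell a.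
have cellk u : (forall i, v i <= u i <= (v i).+1)%N -> forall i, (u i <= k.+1)%N.
  by move=> h i; have /andP[_ h'] := h i; exact: leq_trans h' (vk i).
have cell_ball u : (forall i, v i <= u i <= (v i).+1)%N -> ball (grid v) e (grid u).
  move=> h; split=> // i j; rewrite !mxE; apply: le_lt_trans ke.
  rewrite -mulrBl normrM (ger0_norm (x:=_^-1)) ?invr_ge0 ?ler0n //.
  rewrite ler_piMl ?invr_ge0 ?ler0n // distrC -natrB; last by case/andP: (h j).
  by rewrite normr_nat -[leRHS]/(1%:R) ler_nat leq_subLR addn1; case/andP: (h j).
exists (grid w), (grid w'); split; [split|split| |]; try exact: cell_ball;
  try by apply: grid_cube; exact: cellk.
- move: lw => /andP[_ /orP[kw|//]].
  have -> : grid w ord0 a = 1.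
    have /eqP : (w a == k.+1)%N by rewrite eqn_leq kw cellk.
    by rewrite mxE => ->; rewrite divff ?lt0r_neq0.
  by have /andP[] := fcube _ (grid_cube _ (cellk _ hw)) a.
- move: lw'; rewrite negb_and negbK negb_or => /orP[/eqP wa0|/andP[_]].
    rewrite [X in X <= _]mxE wa0 mul0r.
    by have /andP[] := fcube _ (grid_cube _ (cellk _ hw')) a.
  by rewrite -ltNge => /ltW.
Qed.

(** At a cluster point [p] of almost fixed points of increasing precision, each coordinate of
    [f x - x] takes values of both weak signs arbitrarily near [p], so by continuity it vanishes at
    [p]. *)
Theorem brouwer_cube (R : realType) n (f : 'rV[R]_n -> 'rV[R]_n) :
  {within @cube R n, continuous f} -> (forall t, cube t -> cube (f t)) ->
  exists2 t, cube t & f t = t.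
Proof.
move=> cf fcube.
have /choice[c hc] : forall k : nat, exists c, cube c /\ forall a, exists x y,
    [/\ cube x /\ ball c k.+1%:R^-1 x, cube y /\ ball c k.+1%:R^-1 y,
        f x ord0 a <= x ord0 a & y ord0 a <= f y ord0 a].
  move=> k; have [|c] := @cube_almost_fixed R n f k.+1%:R^-1 fcube.
    by rewrite invr_gt0 ltr0Sn.
  by exists c.
have [|p [cp clp]] := @cube_compact R n (c @ \oo) _.
  by exists 0%N => // k _; exact: (hc k).1.
exists p => //; apply/rowP => a.
pose h (x : 'rV[R]_n) : R := f x ord0 a - x ord0 a.
have ch : h @ within (@cube R n) (nbhs p) --> h p.
  apply: cvgB.
    apply: (@cvg_comp _ _ _ f (fun M : 'rV[R]_n => M ord0 a)).
      by move/subspace_continuousP : cf; apply.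
    exact: coord_continuous.
  apply: cvg_trans (@coord_continuous R 1 n ord0 a p).
  exact/cvg_app/cvg_within.
have cells (P : set R) : nbhs (h p) P -> exists x y, [/\ P (h x), P (h y), h x <= 0 & 0 <= h y].
  move=> /ch Ph.
  have /nbhs_ballP[e /= e0 eP] : nbhs p [set x | cube x -> P (h x)] := Ph.
  have e20 : 0 < e / 2 by rewrite divr_gt0.
  have [K Ke] : exists K : nat, K.+1%:R^-1 < e / 2.
    exists (Num.trunc (e / 2)^-1); rewrite invf_plt ?posrE ?ltr0Sn //; exact: truncnS_gt.
  have [_ [[k /= Kk <-] pck]] : [set c k | k in [set k | (K <= k)%N]] `&` ball p (e / 2) !=set0.
    apply: clp; last exact: nbhsx_ballx.
    by exists K => // k /= Kk; exists k.
  have [_ /(_ a)[x [y [[cx bx] [cy by_] fx fy]]]] := hc k.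
  have near_p z : ball (c k) k.+1%:R^-1 z -> ball p e z.
    move=> bz; apply: (ball_splitr (z := c k)); first exact: ball_sym.
    apply: le_ball bz; apply: le_trans (ltW Ke).
    by rewrite lef_pV2 ?posrE ?ltr0Sn // ler_nat.
  exists x, y; split; [exact/eP/cx/near_p|exact/eP/cy/near_p| |].
    by rewrite subr_le0.
  by rewrite subr_ge0.
apply/eqP; rewrite -subr_eq0 -/(h p); apply/eqP.
case: (ltgtP (h p) 0) => // hp.
  have [_ [y [_ + _]]] := cells [set z | z < 0] (lt_nbhsl hp).
  by rewrite /= => /lt_le_trans h1 /h1; rewrite ltxx.
have [x [_ [+ _ + _]]] := cells [set z | 0 < z] (lt_nbhsr hp).
by rewrite /= => /lt_le_trans h1 /h1; rewrite ltxx.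
Qed.

(** * Continuity in matrix spaces *)

(** Entries in an arbitrary pointed uniform space cover both real and complex vectors. *)
Lemma cvg_rV (U : puniformType) n (T : Type) (F : set_system T) (FF : Filter F)
    (f : T -> 'rV[U]_n) (l : 'rV[U]_n) :
  (forall i, (fun t => f t ord0 i) @ F --> l ord0 i) -> f @ F --> l.
Proof.
move=> fl; apply/cvg_mx_entourageP => A entA.
have : \forall t \near F, forall i, (l ord0 i, f t ord0 i) \in A.
  apply: filter_forall => i; have := fl i; move/cvg_entourageP => /(_ _ entA).
  by rewrite near_map; apply: filterS => t /= h; rewrite inE.
apply: filterS => t h i j; by rewrite (ord1 i).
Qed.

Lemma rV_coord_continuous (U : puniformType) n (i : 'I_n) :
  continuous (fun M : 'rV[U]_n => M ord0 i).
Proof.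
move=> M; have MF : Filter (nbhs M) := nbhs_filter M.
apply/(@cvg_entourageP _ _ (fmap_filter _ MF)) => A entA; rewrite near_map.
have := (@cvg_mx_entourageP U 1 n (nbhs M) MF M).1 (@cvg_id _ _) A entA.
by apply: filterS => N /(_ ord0 i); rewrite inE.
Qed.

Lemma within_continuous_precomp (U V W : topologicalType) (A : set U) (B : set V)
    (g : U -> V) (H : V -> W) :
  {within B, continuous H} -> continuous g -> (forall x, A x -> B (g x)) ->
  {within A, continuous (H \o g)}.
Proof.
move=> /subspace_continuousP cH cg gAB; apply/subspace_continuousP => x Ax P /= PH.
have gP : nbhs x [set y | B (g y) -> P (H (g y))] := cg x _ (cH (g x) (gAB _ Ax) _ PH).
suff : nbhs x [set y | A y -> P (H (g y))] by [].
by apply: filterS gP => y /= h /gAB/h.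
Qed.

(* The canonical neighborhood filter of a matrix space unfolds during the
   unification triggered by the [cvg] lemmas, which then find no [Filter]
   instance; an abstract filter avoids this. *)
Lemma continuous_cvg_filter (T U : topologicalType) (f : T -> U) :
  (forall (F : set_system T) t, Filter F -> F --> t -> f @ F --> f t) -> continuous f.
Proof. by move=> h t; apply: h; exact: cvg_id. Qed.

Lemma cvg_continuous_at (T U : topologicalType) (f : T -> U) (F : set_system T) t :
  continuous f -> F --> t -> f @ F --> f t.
Proof. by move=> fc Ft; apply: cvg_trans (fc t); exact: cvg_app. Qed.

Lemma cvg_coord (U : puniformType) n (F : set_system 'rV[U]_n) (p : 'rV[U]_n) l :
  F --> p -> (fun x : 'rV[U]_n => x ord0 l) @ F --> p ord0 l.
Proof. exact: (cvg_continuous_at (@rV_coord_continuous U n l)). Qed.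

Lemma continuous_rV (U : puniformType) (T : topologicalType) k (f : T -> 'rV[U]_k) :
  (forall a, continuous (fun t => f t ord0 a)) -> continuous f.
Proof. by move=> fc t; apply: cvg_rV => a; exact: fc. Qed.

(** * A nontrivial map on the boundary of a cube *)

Lemma rV_coord_le_norm (R : realType) n (x : 'rV[R]_n) a : `|x ord0 a| <= `|x|.
Proof.
by rewrite [leRHS]/Num.norm /= mx_normrE; apply/bigmax_geP; right => /=; exists (ord0, a).
Qed.

Lemma rV_norm_attained (R : realType) n (x : 'rV[R]_n) :
  x != 0 -> exists a, `|x| = `|x ord0 a|.
Proof.
rewrite -normr_eq0 => /mx_norm_neq0[[i a] /= xa]; exists a.
by rewrite [LHS]xa (ord1 i).
Qed.

Section Pinch.
Variables (R : realType) (n : nat).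
Implicit Types (t : 'rV[R]_n) (y : 'rV[R]_n.+1).

(** Coordinate [ord0] of the larger cube will be the time of a homotopy; the tail is the point being
    moved. *)
Definition tail y : 'rV[R]_n := \row_k y ord0 (lift ord0 k).

(** Each factor is [4 * t_k * (1 - t_k)]: a bump equal to 0 on the boundary and 1 at the center. *)
Definition cutoff t : R := \prod_k (1 - (2 * t ord0 k - 1) ^+ 2).

(* Up to positive scaling, a degree one map from the cube modulo its boundary
   to the sphere: on the boundary it is the first basis vector, at the center its
   opposite. *)
Definition pinch t : 'rV[R]_n.+1 :=
  \row_a if unlift ord0 a is Some k then cutoff t * (2 * t ord0 k - 1) else 1 - 2 * cutoff t.

Lemma pinch0 t : pinch t ord0 ord0 = 1 - 2 * cutoff t.
Proof. by rewrite mxE unlift_none. Qed.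

Lemma pinch_lift t k : pinch t ord0 (lift ord0 k) = cutoff t * (2 * t ord0 k - 1).
Proof. by rewrite mxE liftK. Qed.

Lemma cutoff_ge0 t : cube t -> 0 <= cutoff t.
Proof. move=> ct; apply: prodr_ge0 => k _; have := ct k; nra. Qed.

Lemma cutoff_center t : (forall k, 2 * t ord0 k - 1 = 0) -> cutoff t = 1.
Proof. by move=> t0; rewrite /cutoff big1 // => k _; rewrite t0 expr0n subr0. Qed.

Lemma pinch_boundary t : cube_boundary t -> pinch t = delta_mx ord0 ord0.
Proof.
move=> [_ [k tk]]; have b0 : cutoff t = 0.
  by rewrite /cutoff (bigD1 k) //=; case: tk => ->; rewrite [X in X * _](_ : _ = 0) ?mul0r //; ring.
apply/rowP => a; rewrite [RHS]mxE eqxx /=; case: (unliftP ord0 a) => [l|] ->.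
  by rewrite pinch_lift b0 mul0r.
by rewrite pinch0 b0 mulr0 subr0.
Qed.

(** At a zero the first entry forces [cutoff t = 1/2], so the other entries force [t] to be the
    center, where the cutoff is 1. *)
Lemma pinch_neq0 t : pinch t != 0.
Proof.
apply/eqP => p0; have := congr1 (fun x : 'rV_n.+1 => x ord0 ord0) p0.
rewrite /= pinch0 mxE => b2.
have b0 : cutoff t != 0 by apply: contra_eq_neq b2 => ->; rewrite mulr0 subr0 oner_neq0.
have : cutoff t = 1.
  apply: cutoff_center => k; have := congr1 (fun x : 'rV_n.+1 => x ord0 (lift ord0 k)) p0.
  by rewrite /= pinch_lift mxE => /eqP; rewrite mulf_eq0 (negbTE b0) => /eqP.
by move=> b1; move: b2; rewrite b1; lra.
Qed.

Lemma tail_continuous : continuous tail.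
Proof.
apply: continuous_rV => k.
rewrite (_ : (fun _ => _) = (fun y : 'rV[R]_n.+1 => y ord0 (lift ord0 k))).
  exact: rV_coord_continuous.
by apply: funext => y; rewrite mxE.
Qed.

Let cvg_coordB (F : set_system 'rV[R]_n) (t : 'rV[R]_n) (k : 'I_n) : Filter F -> F --> t ->
  (fun x : 'rV[R]_n => 2 * x ord0 k - 1) @ F --> 2 * t ord0 k - 1.
Proof.
move=> FF Ft; apply: cvgB; last exact: cvg_cst.
apply: cvgM; first exact: cvg_cst.
exact: (@cvg_coord R n F t k Ft).
Qed.

Lemma cutoff_continuous : continuous cutoff.
Proof.
apply: continuous_cvg_filter => F t FF Ft; apply: cvg_big; first exact: mul_continuous.
move=> k _; apply: cvgB; first exact: cvg_cst.
by apply: cvgM; exact: cvg_coordB.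
Qed.

Lemma pinch_continuous : continuous pinch.
Proof.
apply: continuous_cvg_filter => F t FF Ft; apply: cvg_rV => a.
have cb := cvg_continuous_at cutoff_continuous Ft.
case: (unliftP ord0 a) => [k|] ->.
  under eq_fun do rewrite pinch_lift.
  by rewrite pinch_lift; apply: cvgM => //; exact: cvg_coordB.
under eq_fun do rewrite pinch0.
rewrite pinch0; apply: cvgB; first exact: cvg_cst.
by apply: cvgM => //; exact: cvg_cst.
Qed.

(* [G] restricted to the boundary of the cube is never antipodal to the radial
   map [y |-> 2 y - 1]; so if [G] had no zero, [y |-> (1 - G y / |G y|) / 2] would
   have no fixed point. *)
Lemma pinch_not_null (G : 'rV[R]_n.+1 -> 'rV[R]_n.+1) :
  {within @cube R n.+1, continuous G} ->
  (forall y, cube y -> G y != 0) ->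
  (forall y, cube y -> y ord0 ord0 = 0 ->
     exists2 c, 0 < c & G y = c *: pinch (tail y)) ->
  (forall y, cube y -> y ord0 ord0 = 1 \/ cube_boundary (tail y) ->
     G y = delta_mx ord0 ord0) ->
  False.
Proof.
move=> cG G0 bottom rest.
pose P y : 'rV[R]_n.+1 := 2^-1 *: (const_mx 1 - `|G y|^-1 *: G y).
have PE y a : 2 * P y ord0 a - 1 = - (G y ord0 a / `|G y|).
  by rewrite !mxE; lra.
have [||y cy Py] := @brouwer_cube R n.+1 P.
- apply/subspace_continuousP => y cy; apply: cvgZl_tmp; apply: cvgB; first exact: cvg_cst.
  have cGy : G @ within (@cube R n.+1) (nbhs y) --> G y by move/subspace_continuousP : cG; exact.
  apply: (cvgZ _ cGy); apply: cvgV; first by rewrite normr_eq0 G0.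
  exact: (cvg_norm cGy).
- move=> y cy a; have := PE y a.
  have Gy : 0 < `|G y| by rewrite normr_gt0 G0.
  have : `|G y ord0 a / `|G y| | <= 1.
    by rewrite normrM normfV normr_id ler_pdivrMr // mul1r rV_coord_le_norm.
  by rewrite ler_norml => /andP[h1 h2] h3; apply/andP; split; lra.
have Gy : 0 < `|G y| by rewrite normr_gt0 G0.
have fixE a : 2 * y ord0 a - 1 = - (G y ord0 a / `|G y|) by rewrite -PE // Py.
(* On the bottom face each tail coordinate [u] of [2 y - 1] is a nonpositive multiple of itself, so
   the tail is the center. There the first entry of [pinch] is -1, the same sign as [2 * 0 - 1], not
   the opposite one. *)
have [y0|y0] := eqVneq (y ord0 ord0) 0.
  have [c c0 Gc] := bottom _ cy y0.
  have ct : cube (tail y) by move=> k; rewrite mxE.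
  have b0 := cutoff_ge0 ct.
  have b1 : cutoff (tail y) = 1.
    apply: cutoff_center => k; have := fixE (lift ord0 k).
    rewrite Gc [X in - (X / _)]mxE pinch_lift -Gc mxE.
    set u := 2 * _ - 1 => /eqP; rewrite -subr_eq0.
    rewrite (_ : _ - _ = u * (1 + c * cutoff (tail y) / `|G y|)); last by ring.
    rewrite mulf_eq0 => /orP[/eqP//|]; rewrite paddr_eq0 ?ler01 ?oner_eq0 //.
    by rewrite divr_ge0 ?mulr_ge0 // ltW.
  have := fixE ord0; rewrite y0 Gc [X in - (X / _)]mxE pinch0 -Gc b1.
  have : 0 < c / `|G y| by rewrite divr_gt0.
  by move=> h1; rewrite mulrAC; nra.
(* Off the bottom face, an index where the sup norm of [G y] is attained satisfies
   [|2 y_a - 1| = 1]. So [y] lies on another facet, [G y] is the basis vector, and the fixed point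
   equation gives [y ord0 ord0 = 0] after all. *)
have [a Ga] := rV_norm_attained (G0 _ cy).
have ya : y ord0 a = 0 \/ y ord0 a = 1.
  have : `|2 * y ord0 a - 1| = 1.
    by rewrite fixE normrN normrM normfV normr_id -Ga divff ?gt_eqF.
  by move=> /eqP; rewrite eqr_norml ler01 andbT => /orP[] /eqP h; [right|left]; lra.
have Gd : G y = delta_mx ord0 ord0.
  apply: rest => //; move: ya; case: (unliftP ord0 a) => [k|] -> ya.
    by right; split; [move=> l; rewrite mxE|exists k; rewrite mxE].
  by case: ya => [/eqP|]; [rewrite (negbTE y0)|left].
have Gn : `|G y| = 1.
  move: (Ga); rewrite Gd mxE eqxx /= => Ga1.
  by move: Gy; rewrite Gd Ga1; case: eqP => // _; rewrite ?normr1 ?normr0 ?ltxx.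
have := fixE ord0; rewrite Gn Gd mxE eqxx /= => h; move: y0; rewrite (_ : y _ _ = 0) ?eqxx //.
by lra.
Qed.

End Pinch.

(** * The sphere of a missing edge *)

Section Complex.
Variable R : realType.
Local Notation C := (R[i]^o).

(** The radii in the metric of [R[i]] are themselves complex; this turns them into real ones. *)
Lemma complex_gt0 (e : R[i]) : 0 < e -> e = (complex.Re e)%:C%C /\ 0 < complex.Re e.
Proof. by case: e => x y; rewrite ltcE /= => /andP[/eqP -> ->]. Qed.

Lemma cvg_Complex (T : Type) (F : set_system T) (FF : Filter F) (a b : T -> R) (x y : R) :
  a @ F --> x -> b @ F --> y ->
  (fun t => (a t +i* b t)%C : C) @ F --> ((x +i* y)%C : C).
Proof.
move=> /cvgrPdist_lt ax /cvgrPdist_lt bY; apply/cvgrPdist_lt => e.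
move=> /complex_gt0[-> e0]; set r := complex.Re e in e0 *.
have r20 : 0 < r / 2 by rewrite divr_gt0.
near=> t.
have h1 : `|x - a t| < r / 2 by near: t; exact: ax.
have h2 : `|y - b t| < r / 2 by near: t; exact: bY.
rewrite normc_def ltcR /=.
rewrite -/r -(ger0_norm (ltW e0)) -sqrtr_sqr ltr_sqrt ?exprn_gt0 //.
have : (x - a t) ^+ 2 < (r / 2) ^+ 2.
  by rewrite -(real_normK (num_real (x - a t))) ltrXn2r ?nnegrE // ltW.
have : (y - b t) ^+ 2 < (r / 2) ^+ 2.
  by rewrite -(real_normK (num_real (y - b t))) ltrXn2r ?nnegrE // ltW.
nra.
Unshelve. all: by end_near. Qed.

Lemma Re_continuous : continuous (fun z : C => complex.Re z : R).
Proof.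
move=> z; have zF : Filter (nbhs z) := nbhs_filter z.
apply/(@cvgrPdist_lt _ _ _ _ zF) => e e0.
apply/nbhs_ballP; exists (e%:C)%C; rewrite /= ?ltcR // => w.
rewrite -ball_normE /= => h; rewrite -ltcR; apply: le_lt_trans h.
have -> : complex.Re z - complex.Re w = complex.Re (z - w : R[i]) by move: {zF} z w => [? ?] [? ?].
exact: normc_ge_Re.
Qed.

Lemma Im_continuous : continuous (fun z : C => complex.Im z : R).
Proof.
move=> z; have zF : Filter (nbhs z) := nbhs_filter z.
apply/(@cvgrPdist_lt _ _ _ _ zF) => e e0.
apply/nbhs_ballP; exists (e%:C)%C; rewrite /= ?ltcR // => w.
rewrite -ball_normE /= => h; rewrite -ltcR; apply: le_lt_trans h.
have -> : complex.Im z - complex.Im w = complex.Im (z - w : R[i]) by move: {zF} z w => [? ?] [? ?].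
rewrite normc_def lecR -sqrtr_sqr; apply: ler_wsqrtr.
by rewrite lerDr sqr_ge0.
Qed.

Lemma normc_eq1 (a b : R) : (`|(a +i* b)%C| == 1 :> R[i]) = (a ^+ 2 + b ^+ 2 == 1).
Proof.
rewrite normc_def eq_complex /= eqxx andbT -[in LHS]sqrtr1.
by rewrite eqr_sqrt ?addr_ge0 ?sqr_ge0.
Qed.

Lemma normc_le1 (a b : R) : (`|(a +i* b)%C| <= 1 :> R[i]) = (a ^+ 2 + b ^+ 2 <= 1).
Proof.
rewrite normc_def lecR -[in LHS]sqrtr1.
by rewrite ler_psqrt ?nnegrE ?addr_ge0 ?sqr_ge0.
Qed.

End Complex.

(** * The 3-sphere in the moment-angle complex *)

Section Sphere.
Variable R : realType.

Local Notation o0 := (@Ordinal 4 0 isT).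
Local Notation o1 := (@Ordinal 4 1 isT).
Local Notation o2 := (@Ordinal 4 2 isT).
Local Notation o3 := (@Ordinal 4 3 isT).

(** This is [max(|z_i|, |z_j|)] on pairs of complex numbers; its unit sphere is the boundary of the
    bidisk. *)
Definition polynorm (p : 'rV[R]_4) : R :=
  Num.max (Num.sqrt (p ord0 o0 ^+ 2 + p ord0 o1 ^+ 2))
          (Num.sqrt (p ord0 o2 ^+ 2 + p ord0 o3 ^+ 2)).

Lemma polynorm_continuous : continuous polynorm.
Proof.
pose sq a b (p : 'rV[R]_4) := Num.sqrt (p ord0 a ^+ 2 + p ord0 b ^+ 2).
have sqc a b : continuous (sq a b).
  apply: continuous_cvg_filter => F p FF Fp.
  apply: continuous_cvg; first exact: sqrt_continuous.
  by apply: cvgD; apply: cvgM; exact: (@cvg_coord R 4 F p _ Fp).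
by move=> p; apply: (@continuous_max _ _ (sq o0 o1) (sq o2 o3)); exact: sqc.
Qed.

Lemma polynorm_gt0 p : p != 0 -> 0 < polynorm p.
Proof.
move=> p0; rewrite lt_max !sqrtr_gt0; apply: contraNT p0.
rewrite negb_or -!leNgt => /andP[h1 h2].
have h a : p ord0 a ^+ 2 = 0 -> p ord0 a = 0 by move/eqP; rewrite expf_eq0 => /eqP.
apply/eqP/rowP => a; rewrite mxE; apply: h.
have := sqr_ge0 (p ord0 o0); have := sqr_ge0 (p ord0 o1).
have := sqr_ge0 (p ord0 o2); have := sqr_ge0 (p ord0 o3).
case: a => [[|[|[|[|]]]] ai] //=; rewrite (bool_irrelevance ai isT); lra.
Qed.

Lemma polynormZ c p : 0 <= c -> polynorm (c *: p) = c * polynorm p.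
Proof.
move=> c0; rewrite /polynorm !mxE maxr_pMr // !exprMn -!mulrDr.
by rewrite !(sqrtrM _ (sqr_ge0 c)) !sqrtr_sqr (ger0_norm c0).
Qed.

Variables (m : nat) (K : {set {set 'I_m}}) (i j : 'I_m).
Hypotheses (hK : simplicial_complex K) (ji : j != i) (hij : [set i; j]%SET \notin K).
Local Notation C := (R[i]^o).

Definition emb (p : 'rV[R]_4) : 'rV[C]_m :=
  \row_l if l == i then (p ord0 o0 +i* p ord0 o1)%C
         else if l == j then (p ord0 o2 +i* p ord0 o3)%C else 1.

Definition coords (z : 'rV[C]_m) : 'rV[R]_4 :=
  \row_a [:: complex.Re (z ord0 i); complex.Im (z ord0 i);
             complex.Re (z ord0 j); complex.Im (z ord0 j)]`_a.

Lemma embK : cancel emb coords.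
Proof.
move=> p; apply/rowP => a; rewrite !mxE eqxx (negbTE ji) eqxx /=.
by case: a => [[|[|[|[|]]]] ai] //=; congr (p _ _); apply: val_inj.
Qed.

Lemma emb_continuous : continuous emb.
Proof.
apply: continuous_cvg_filter => F p FF Fp; apply: cvg_rV => l; rewrite /emb mxE.
under eq_fun do rewrite mxE.
case: eqP => _; first by apply: cvg_Complex; exact: (@cvg_coord R 4 F p _ Fp).
case: eqP => _; first by apply: cvg_Complex; exact: (@cvg_coord R 4 F p _ Fp).
exact: cvg_cst.
Qed.

Lemma coords_continuous : continuous coords.
Proof.
apply: continuous_rV => a; rewrite /coords; under eq_fun do rewrite mxE.
have cRe l : continuous (fun z : 'rV[C]_m => complex.Re (z ord0 l) : R).
  move=> z; apply: (@cvg_comp _ _ _ (fun z : 'rV[C]_m => z ord0 l) (fun z : C => complex.Re z)).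
    exact: rV_coord_continuous.
  exact: Re_continuous.
have cIm l : continuous (fun z : 'rV[C]_m => complex.Im (z ord0 l) : R).
  move=> z; apply: (@cvg_comp _ _ _ (fun z : 'rV[C]_m => z ord0 l) (fun z : C => complex.Im z)).
    exact: rV_coord_continuous.
  exact: Im_continuous.
by case: a => [[|[|[|[|]]]] ai] //=; [exact: cRe|exact: cIm|exact: cRe|exact: cIm].
Qed.

(** The larger of the two moduli is 1, so only the other coordinate may leave the circle, and a
    single vertex is a simplex. *)
Lemma emb_moment_angle p : polynorm p = 1 -> moment_angle R K (emb p).
Proof.
move=> p1.
have le1 (x : R) : Num.sqrt x <= 1 -> x <= 1.
  by rewrite -[X in _ <= X -> _]sqrtr1 ler_sqrt.
(* [Num.sqrt] is 0 on negative reals, so the value 1 excludes them. *)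
have eq1 (x : R) : Num.sqrt x = 1 -> x = 1.
  move=> x1; have x0 : 0 <= x.
    by case: (leP 0 x) => // /ltW/ler0_sqrtr; rewrite x1 => /eqP; rewrite oner_eq0.
  by rewrite -(sqr_sqrtr x0) x1 expr1n.
have [_ K1 _] := hK.
rewrite /polynorm in p1.
have [h|h] := leP (Num.sqrt (p ord0 o0 ^+ 2 + p ord0 o1 ^+ 2))
    (Num.sqrt (p ord0 o2 ^+ 2 + p ord0 o3 ^+ 2)).
  rewrite max_r // in p1; rewrite p1 in h.
  exists [set i]%SET; first exact: K1.
  move=> l; rewrite inE /emb mxE; case: (l =P i) => [_|_].
    by rewrite /disk2 /= normc_le1; exact: le1.
  case: (l =P j) => _; last by rewrite /circle1 /= normr1.
  by apply/eqP; rewrite normc_eq1 (eq1 _ p1).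
rewrite max_l ?ltW // in p1; rewrite p1 in h; move/ltW in h.
exists [set j]%SET; first exact: K1.
move=> l; rewrite inE /emb mxE; case: (l =P i) => [->|_].
  rewrite eq_sym (negbTE ji).
  by apply/eqP; rewrite normc_eq1 (eq1 _ p1).
case: (l =P j) => _; last by rewrite /circle1 /= normr1.
by rewrite /disk2 /= normc_le1; exact: le1.
Qed.

(** A vanishing coordinate is off the circle, so its index lies in [J]; if both vanished,
    [[set i; j]] would be a face of [J]. *)
Lemma coords_neq0 z : moment_angle R K z -> coords z != 0.
Proof.
have [_ _ Ksub] := hK.
move=> [J /= JK zJ]; apply: contra hij => /eqP z0.
have zc k : coords z ord0 k = 0 by rewrite z0 mxE.
have inJ l : complex.Re (z ord0 l) = 0 -> complex.Im (z ord0 l) = 0 -> l \in J.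
  move=> r0 i0; have := zJ l; case: ifP => // _; rewrite /circle1 /=.
  by rewrite normc_def r0 i0 expr0n addr0 sqrtr0 => /eqP; rewrite eq_sym oner_eq0.
apply: (Ksub _ J) => //; apply/fintype.subsetP => l; rewrite !inE => /orP[] /eqP ->; apply: inJ.
- by have := zc o0; rewrite mxE.
- by have := zc o1; rewrite mxE.
- by have := zc o2; rewrite mxE.
- by have := zc o3; rewrite mxE.
Qed.

Definition sphere_map (t : 'rV[R]_3) : 'rV[C]_m :=
  emb ((polynorm (pinch t))^-1 *: pinch t).

Let x0 := emb (delta_mx ord0 ord0).

Lemma polynorm_delta : polynorm (delta_mx ord0 ord0) = 1.
Proof. by rewrite /polynorm !mxE /= !expr0n !expr1n !addr0 sqrtr1 sqrtr0 max_l. Qed.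

Lemma sphere_map_spheroid : spheroid (moment_angle R K) x0 sphere_map.
Proof.
have N0 t : 0 < polynorm (pinch t) by apply: polynorm_gt0; exact: pinch_neq0.
split=> [|t _|t bt].
- apply: continuous_subspaceT; apply: continuous_cvg_filter => F t FF Ft.
  apply: (@cvg_comp _ _ _ (fun t => (polynorm (pinch t))^-1 *: pinch t) emb);
    last exact: emb_continuous.
  have cp := cvg_continuous_at (@pinch_continuous R 3) Ft.
  apply: (cvgZ _ cp); apply: cvgV; first by rewrite gt_eqF.
  have cN : (fun t => polynorm (pinch t)) @ F --> polynorm (pinch t).
    apply: (@cvg_comp _ _ _ (@pinch R 3) polynorm); first exact: cp.
    exact: polynorm_continuous.
  exact: cN.
- apply: emb_moment_angle; rewrite polynormZ ?invr_ge0 ?ltW //.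
  by rewrite mulVf // gt_eqF.
- by rewrite /sphere_map pinch_boundary // polynorm_delta invr1 scale1r.
Qed.

(** A null homotopy read through [coords] would contradict [pinch_not_null]: [coords] undoes [emb],
    so at time 0 it is [pinch] up to the positive factor from the normalization. *)
Lemma sphere_map_not_null :
  ~ spheroid_homotopic (moment_angle R K) x0 sphere_map (fun=> x0).
Proof.
move=> [H [cH sH H0 H1]].
pose g (y : 'rV[R]_4) : R * 'rV[R]_3 := (y ord0 ord0, tail y).
have cg : continuous g.
  apply: continuous_cvg_filter => F y FF Fy.
  apply: (@cvg_pair _ _ _ F (nbhs (y ord0 ord0)) (nbhs (tail y)) FF (nbhs_filter _)
    (nbhs_filter _) (fun y : 'rV[R]_4 => y ord0 ord0) (@tail R 3)).
    exact: (@cvg_coord R 4 F y _ Fy).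
  exact: (cvg_continuous_at (@tail_continuous R 3)).
have gcube (y : 'rV[R]_4) : cube y -> cube (tail y) by move=> cy k; rewrite mxE.
have HZ y : cube y -> moment_angle R K (H (g y)).
  by move=> cy; have [_ + _] := sH _ (cy ord0); apply; exact: gcube.
apply: (@pinch_not_null R 3 (fun y => coords (H (g y)))).
- have cHg : {within @cube R 4, continuous (H \o g)}.
    apply: (within_continuous_precomp cH cg) => y cy; split; last exact: gcube.
    by rewrite /= in_itv; exact: cy.
  apply/subspace_continuousP => y cy.
  apply: (@cvg_comp _ _ _ (H \o g) coords); last exact: coords_continuous.
  by move/subspace_continuousP : cHg; apply.
- by move=> y /HZ; exact: coords_neq0.
- move=> y cy y0; exists (polynorm (pinch (tail y)))^-1.
    by rewrite invr_gt0; apply/polynorm_gt0/pinch_neq0.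
  by rewrite /g y0 H0 ?embK //; exact: gcube.
- move=> y cy; rewrite /g => -[->|by_].
    by rewrite H1 ?embK //; exact: gcube.
  by have [_ _ ->] := sH _ (cy ord0); rewrite ?embK.
Qed.

End Sphere.

Theorem lemma2p6 (R : realType) (m : nat) (K : {set {set 'I_m}})
    (hK : simplicial_complex K)
    (hcone : exists i : 'I_m, ~ conelike K i) :
  ~ aspherical R (moment_angle R K).
Proof.
move=> [_ asph]; have [i /existsNP[j /not_implyP[ji /negP hij]]] := hcone.
apply: (@sphere_map_not_null R m K i j hK ji hij).
(* Asphericity would make the third homotopy group trivial and contract [sphere_map]. *)
apply: asph => //; last exact: sphere_map_spheroid.
by apply: emb_moment_angle => //; exact: polynorm_delta.
Qed.
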